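(* Let $H$ be an ordered graph on $h$ vertices. For every $n\in\mathbb N$ with $h\mid n$, there is an $n$-vertex ordered graph $G$ with $\delta(G)\ge\lfloor(1-\alpha^*(H))n\rfloor-1$ that does not contain a perfect $H$-tiling.
   Context: An ordered graph $H$ on $h$ vertices is a graph whose vertices have been labelled with $[h]=\{1,\dots,h\}$. An ordered graph $G$ with vertex set $[n]$ contains $H$ if there is a map $\phi:[h]\to[n]$ with $\phi(i)<\phi(j)$ for all $1\le i<j\le h$ and with $\phi(i)\phi(j)\in E(G)$ whenever $ij\in E(H)$. An $H$-tiling in $G$ is a collection of vertex-disjoint copies of $H$ contained in $G$; it is perfect if it covers all the vertices of $G$. $\delta(G)$ denotes the minimum degree of $G$. The interval chromatic number $\chi_{<}(H)$ is the minimum number of intervals into which $[h]$ can be partitioned so that no two vertices belonging to the same interval are adjacent in $H$. Let $\alpha_0^+(H):=0$ and for $1\le \ell\le\chi_{<}(H)$ let $\alpha_\ell^+(H)$ be the largest $k\in\mathbb N$ (with $k\le h$) such that $[\alpha_{\ell-1}^+(H)+1,k]$ is an independent set in $H$. Let $\alpha_0^-(H):=h+1$ and for $1\le\ell\le\chi_{<}(H)$ let $\alpha_\ell^-(H)$ be the smallest $k\in\mathbb N$ (with $k\ge 1$) such that $[k,\alpha_{\ell-1}^-(H)-1]$ is an independent set in $H$. Define $$\alpha^*(H):=\min_{1\le \ell<\chi_{<}(H)}\min\left\{\frac{\alpha_\ell^+(H)}{\ell\cdot h},\ \frac{h-\alpha_\ell^-(H)+1}{\ell\cdot h}\right\}.$$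 *)

(* Defs.v *)
From HB Require Import structures.
From mathcomp Require Import all_boot all_order all_algebra.

Set Implicit Arguments.
Unset Strict Implicit.
Unset Printing Implicit Defensive.

Import Order.TTheory GRing.Theory Num.Theory.

(* Vertices are elements of 'I_n; the vertex labelled v in [n] = {1, ..., n}
   is the ordinal i with i.+1 = v. *)
Record ordered_graph (n : nat) := OrderedGraph {
  edge :> rel 'I_n;
  edge_sym : symmetric edge;
  edge_irrefl : irreflexive edge
}.

Definition degree n (G : ordered_graph n) (v : 'I_n) : nat :=
  #|[set w | G v w]|.

(* For n > 0 the default value n is never reached, since degrees are < n. *)
Definition min_degree n (G : ordered_graph n) : nat :=
  \big[minn/n]_(v : 'I_n) degree G v.

Definition independent n (G : ordered_graph n) (A : {set 'I_n}) : bool :=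
  [forall i in A, forall j in A, ~~ G i j].

Definition embedding h n (H : ordered_graph h) (G : ordered_graph n)
    (phi : {ffun 'I_h -> 'I_n}) : Prop :=
  (forall i j : 'I_h, i < j -> phi i < phi j) /\
  (forall i j : 'I_h, H i j -> G (phi i) (phi j)).

Definition vertices h n (phi : {ffun 'I_h -> 'I_n}) : {set 'I_n} :=
  [set phi i | i : 'I_h].

(* A copy of H is represented by its embedding, which is determined by the
   vertex set of the copy because embeddings are increasing. *)
Definition tiling h n (H : ordered_graph h) (G : ordered_graph n)
    (T : {set {ffun 'I_h -> 'I_n}}) : Prop :=
  (forall phi, phi \in T -> embedding H G phi) /\
  (forall phi psi, phi \in T -> psi \in T -> phi != psi ->
     [disjoint vertices phi & vertices psi]).

Definition perfect_tiling h n (H : ordered_graph h) (G : ordered_graph n)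
    (T : {set {ffun 'I_h -> 'I_n}}) : Prop :=
  tiling H G T /\ \bigcup_(phi in T) vertices phi = [set: 'I_n].

Definition is_interval n (A : {set 'I_n}) : bool :=
  [forall i in A, forall k in A, forall j : 'I_n, (i <= j <= k) ==> (j \in A)].

Definition interval_colouring n (H : ordered_graph n)
    (P : {set {set 'I_n}}) : bool :=
  partition P [set: 'I_n] &&
  [forall A in P, is_interval A && independent H A].

(* The default value h is attained by the partition into singletons. *)
Definition interval_chromatic h (H : ordered_graph h) : nat :=
  \big[minn/h]_(P : {set {set 'I_h}} | interval_colouring H P) #|P|.

(* The vertices with labels in [a, b], labels being counted from 1. *)
Definition segment n (a b : nat) : {set 'I_n} :=
  [set i : 'I_n | a <= i.+1 <= b].

Fixpoint alpha_plus h (H : ordered_graph h) (l : nat) : nat :=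
  if l is l'.+1 then
    \max_(0 <= k < h.+1 | independent H (segment h (alpha_plus H l').+1 k)) k
  else 0.

(* The segment is empty, hence independent, for k = alpha_minus H l', which
   lies in [1, h + 1]; so the default value h.+1 does not affect the minimum. *)
Fixpoint alpha_minus h (H : ordered_graph h) (l : nat) : nat :=
  if l is l'.+1 then
    \big[minn/h.+1]_(1 <= k < h.+2 |
        independent H (segment h k (alpha_minus H l').-1)) k
  else h.+1.

Local Open Scope ring_scope.

Definition alpha_ratio h (H : ordered_graph h) (l : nat) : rat :=
  Num.min ((alpha_plus H l)%:R / (l * h)%:R)
          ((h%:R - (alpha_minus H l)%:R + 1) / (l * h)%:R).

(* A minimum over 1 <= l < interval_chromatic H, meaningful only when this
   range is nonempty; it then contains l = 1, so that the default value is one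
   of the terms. *)
Definition alpha_star h (H : ordered_graph h) : rat :=
  \big[Num.min/alpha_ratio H 1]_(1 <= l < interval_chromatic H) alpha_ratio H l.

(* Main.v *)
(** Suppose the minimum defining alpha^* is attained as beta / (l h), where beta
    is alpha_l^+ or h - alpha_l^- + 1.  Cut the first (resp. last) part of [n]
    into l consecutive intervals of size s = floor(alpha^* n) + 1 (truncated if
    they do not fit), make them independent and add all other edges.  A copy
    of H meets the union of the intervals in an initial (resp. final) segment
    of H covered by l independent intervals, hence in at most beta vertices, as
    the greedy choice is optimal.  So n / h disjoint copies cover at most
    beta n / h < l s vertices of the union.  If the intervals exhaust [n], then
    G has no copy of H at all, since l is less than the interval chromatic
    number. *)

Require Import Defs.
From HB Require Import structures.
From mathcomp Require Import all_boot all_order all_algebra.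

Set Implicit Arguments.
Unset Strict Implicit.
Unset Printing Implicit Defensive.

Import Order.TTheory GRing.Theory Num.Theory.

(** * Minima and cardinalities over ordinals *)

Lemma geq_bigmin_seq (I : eqType) (r : seq I) (P : pred I) (F : I -> nat) x i :
  i \in r -> P i -> \big[minn/x]_(j <- r | P j) F j <= F i.
Proof.
elim: r => // j r IHr; rewrite inE big_cons => /orP[/eqP <- -> | ri Pi].
  exact: geq_minl.
by case: ifP => _; rewrite ?geq_min ?(IHr ri Pi) ?orbT.
Qed.

Lemma card_ord_ltn n k : k <= n -> #|[set i : 'I_n | i < k]| = k.
Proof.
move=> le_kn; rewrite -[RHS]card_ord -cardsT.
have inj : injective (widen_ord le_kn) by move=> i j [] /val_inj.
rewrite -(card_imset _ inj); apply: eq_card => i.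
rewrite inE; apply/idP/imsetP => [lt_ik | [j _ ->]]; last exact: (ltn_ord j).
by exists (Ordinal lt_ik) => //; apply: val_inj.
Qed.

Lemma leq_card_ord_ltn n (A : {set 'I_n}) k :
  (forall i, i \in A -> i < k) -> #|A| <= k.
Proof.
move=> ltA; case: (leqP k n) => [le_kn | /ltnW le_nk].
  rewrite -[leqRHS](card_ord_ltn le_kn); apply/subset_leq_card/subsetP => i.
  by rewrite inE => /ltA.
by apply: leq_trans le_nk; rewrite -[leqRHS]card_ord max_card.
Qed.

Lemma card_ord_divn n s q : 0 < s -> #|[set i : 'I_n | i %/ s == q]| <= s.
Proof.
move=> s_gt0; pose r (i : 'I_n) := Ordinal (ltn_pmod i s_gt0).
rewrite -[leqRHS]card_ord -(card_in_imset (f := r)) ?max_card // => i j.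
rewrite !inE => /eqP qi /eqP qj [] eq_r.
by apply: val_inj; rewrite /= (divn_eq i s) (divn_eq j s) qi qj eq_r.
Qed.

(** * Complete graphs with some classes made independent *)

Section ClassGraph.

Variables (n : nat) (c : 'I_n -> nat) (l : nat).

(** Only classes below [l] lose their edges; the vertices outside the chosen intervals keep full
    degree. *)
Definition class_edge : rel 'I_n :=
  fun u v => (u != v) && ~~ ((c u == c v) && (c u < l)).

Lemma class_edge_sym : symmetric class_edge.
Proof.
move=> u v; rewrite /class_edge eq_sym [c u == _]eq_sym.
by case: (c v =P c u) => // ->.
Qed.

Lemma class_edge_irrefl : irreflexive class_edge.
Proof. by move=> u; rewrite /class_edge eqxx. Qed.

Definition class_graph := OrderedGraph class_edge_sym class_edge_irrefl.

(** The non-neighbours of [u] form its class if [c u < l]; otherwise [u] is the only one, which is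
    where [0 < s] enters. *)
Lemma class_graph_min_degree s :
  0 < s -> (forall q, #|[set v | c v == q]| <= s) ->
  n - s <= min_degree class_graph.
Proof.
move=> s_gt0 fibre_le; rewrite /min_degree.
elim/big_ind: _ => [|x y|u _]; first exact: leq_subr.
  by rewrite leq_min => -> ->.
rewrite leq_subLR -[leqLHS]card_ord -(cardsC [set w | class_graph u w]) addnC.
rewrite leq_add2r; case: (ltnP (c u) l) => lt_cl.
  apply: leq_trans (fibre_le (c u)); apply/subset_leq_card/subsetP => w.
  rewrite !inE /= /class_edge negb_and !negbK lt_cl andbT.
  by case/orP => /eqP ->.
apply: leq_trans s_gt0; rewrite -(cards1 u).
apply/subset_leq_card/subsetP => w; rewrite !inE /= /class_edge.
by rewrite [c u < l]ltnNge lt_cl andbF andbT negbK eq_sym.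
Qed.

Lemma class_graph_embedding h (H : ordered_graph h) (phi : {ffun 'I_h -> 'I_n}) :
  embedding H class_graph phi ->
  forall i j, c (phi i) < l -> c (phi i) = c (phi j) -> ~~ H i j.
Proof.
case=> _ edge_phi i j lt_cl eq_c; apply/negP => /edge_phi /=.
by rewrite /class_edge eq_c eqxx -eq_c lt_cl andbF.
Qed.

End ClassGraph.

(** * Copies of [H] and double counting over a tiling *)

Lemma embedding_homo_leq h n (H : ordered_graph h) (G : ordered_graph n) phi :
  embedding H G phi -> forall i j : 'I_h, i <= j -> phi i <= phi j.
Proof.
case=> lt_phi _ i j; rewrite leq_eqVlt => /orP[/eqP/val_inj -> //|].
by move/lt_phi/ltnW.
Qed.

Lemma embedding_inj h n (H : ordered_graph h) (G : ordered_graph n) phi :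
  embedding H G phi -> injective phi.
Proof.
case=> lt_phi _ i j eq_phi; apply: val_inj.
case: (ltngtP i j) => // /lt_phi; by rewrite eq_phi ltnn.
Qed.

(** Double counting: the [n / h] copies partition the vertices and each meets [A] at most [b] times.
    The factor [h] avoids a division. *)
Lemma perfect_tiling_card_leq h n (H : ordered_graph h) (G : ordered_graph n)
    T (A : {set 'I_n}) b :
  perfect_tiling H G T ->
  (forall phi, embedding H G phi -> #|[set i | phi i \in A]| <= b) ->
  #|A| * h <= b * n.
Proof.
case=> -[embT disjT] coverT leA.
have inT phi : phi \in T -> #|vertices phi| = h.
  by move=> /embT/embedding_inj inj; rewrite card_imset ?card_ord.
(* Each vertex lies in exactly one copy, so exchanging the sums counts it once. *)
have cardE (B : {set 'I_n}) : #|B| = \sum_(phi in T) #|B :&: vertices phi|.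
  under eq_bigr do rewrite -sum1_card.
  rewrite (exchange_big_dep (mem B)) /= => [|phi x _]; last first.
    by rewrite inE => /andP[].
  rewrite -sum1_card; apply: eq_bigr => x Bx.
  have: x \in \bigcup_(phi in T) vertices phi by rewrite coverT inE.
  case/bigcupP=> phi Tphi phi_x; rewrite (big_pred1 phi) // => psi.
  rewrite inE Bx /=; apply/andP/eqP => [[Tpsi psi_x] | ->] //.
  apply: contraTeq phi_x => neq_psi.
  by rewrite (disjointFr (disjT _ _ Tpsi Tphi neq_psi) psi_x).
have cardT : #|T| * h = n.
  rewrite -[RHS]card_ord -cardsT cardE -sum_nat_const.
  by apply: eq_bigr => phi Tphi; rewrite setTI inT.
rewrite -[leqRHS](congr1 (muln b) cardT) mulnCA mulnA.
rewrite leq_mul2r orbC cardE -sum_nat_const leq_sum // => phi Tphi.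
apply: leq_trans (leA _ (embT _ Tphi)).
rewrite -[leqRHS](card_imset _ (embedding_inj (embT _ Tphi))).
apply/subset_leq_card/subsetP => x /setIP[Ax /imsetP[i _ def_x]].
by rewrite def_x imset_f // inE -def_x.
Qed.

(** * Interval colourings and the greedy choice *)

(** The fibres of [d] form an interval colouring: [convex] makes them intervals, [indep] makes them
    independent. *)
Lemma class_chromatic_leq h (H : ordered_graph h) (d : 'I_h -> nat) l :
  (forall i, d i < l) ->
  (forall i j k : 'I_h, i <= j <= k -> d i = d k -> d j = d i) ->
  (forall i j, d i = d j -> ~~ H i j) ->
  interval_chromatic H <= l.
Proof.
move=> lt_dl convex indep.
pose d' i := Ordinal (lt_dl i); pose P := preim_partition d' [set: 'I_h].
have sameP A i j : A \in P -> i \in A -> (j \in A) = (d i == d j).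
  move=> AP iA; have := preim_partitionP d' [set: 'I_h].
  case/and3P=> _ tiP _.
  rewrite -(def_pblock tiP AP iA) pblock_equivalence_partition ?inE //.
  by move=> x y z _ _ _; split=> // /eqP ->.
have PP : interval_colouring H P.
  rewrite /interval_colouring preim_partitionP /=.
  apply/forall_inP => A AP; apply/andP; split.
    apply/forall_inP => i iA; apply/forall_inP => k kA.
    apply/forallP => j; apply/implyP => ijk.
    rewrite (sameP A i) // eq_sym; apply/eqP/(convex i j k) => //.
    by apply/eqP; rewrite -(sameP A i).
  apply/forall_inP => i iA; apply/forall_inP => j jA.
  by apply: indep; apply/eqP; rewrite -(sameP A i).
apply: leq_trans (_ : #|P| <= l).
  exact: geq_bigmin_seq _ _ (mem_index_enum P) PP.
(* Some values below [l] may be missed, so [P] is only contained in the image of [fibre]. *)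
pose fibre (q : 'I_l) := [set i | d i == q].
rewrite -[leqRHS]card_ord -cardsT.
apply: leq_trans (leq_imset_card fibre _); apply/subset_leq_card/subsetP.
move=> A AP; have /set0Pn[i iA] : A != set0.
  have /and3P[_ _ notP0] := preim_partitionP d' [set: 'I_h].
  by apply: contraNneq notP0 => <-.
apply/imsetP; exists (d' i); rewrite ?inE //; apply/setP => j.
by rewrite inE (sameP A i) //= eq_sym.
Qed.

(** Induction on [k]: past the first [alpha_plus H k] vertices no class below [k] remains. Hence the
    segment from there to a vertex of class at most [k] lies inside class [k], and its end competes
    in the next maximum. *)
Lemma alpha_plus_greedy h (H : ordered_graph h) (d : 'I_h -> nat) l :
  (forall i j : 'I_h, i <= j -> d i <= d j) ->
  (forall i j, d i < l -> d i = d j -> ~~ H i j) ->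
  forall i : 'I_h, d i < l -> i < alpha_plus H l.
Proof.
move=> homo_d indep.
suff main k : k <= l -> forall i : 'I_h, d i < k -> i < alpha_plus H k by exact: main.
elim: k => //= k IHk lt_kl i; rewrite ltnS => le_dk.
have in_class j : j \in segment h (alpha_plus H k).+1 i.+1 -> d j = k.
  rewrite inE !ltnS => /andP[le_aj le_ji]; apply/eqP.
  rewrite eqn_leq (leq_trans (homo_d _ _ le_ji) le_dk) leqNgt.
  by apply: contraL le_aj => /(IHk (ltnW lt_kl)); rewrite -ltnNge.
have ind : independent H (segment h (alpha_plus H k).+1 i.+1).
  apply/forall_inP => x /in_class dx; apply/forall_inP => y /in_class dy.
  by apply: indep; rewrite dx ?dy.
have i_in : i.+1 \in index_iota 0 h.+1 by rewrite mem_index_iota ltnS ltn_ord.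
exact: (@leq_bigmax_seq _ _ _ id _ i_in ind).
Qed.

(** Mirror image of [alpha_plus_greedy], with classes numbered from the right. *)
Lemma alpha_minus_greedy h (H : ordered_graph h) (d : 'I_h -> nat) l :
  (forall i j : 'I_h, i <= j -> d j <= d i) ->
  (forall i j, d i < l -> d i = d j -> ~~ H i j) ->
  forall i : 'I_h, d i < l -> alpha_minus H l <= i.+1.
Proof.
move=> homo_d indep.
suff main k : k <= l -> forall i : 'I_h, d i < k -> alpha_minus H k <= i.+1.
  exact: main.
elim: k => //= k IHk lt_kl i; rewrite ltnS => le_dk.
have in_class j : j \in segment h i.+1 (alpha_minus H k).-1 -> d j = k.
  rewrite inE ltnS => /andP[le_ij le_ja]; apply/eqP.
  rewrite eqn_leq (leq_trans (homo_d _ _ le_ij) le_dk) leqNgt.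
  apply: contraL le_ja => /(IHk (ltnW lt_kl)).
  by case: (alpha_minus H k) => //= a; rewrite ltnS -ltnNge ltnS.
have ind : independent H (segment h i.+1 (alpha_minus H k).-1).
  apply/forall_inP => x /in_class dx; apply/forall_inP => y /in_class dy.
  by apply: indep; rewrite dx ?dy.
have i_in : i.+1 \in index_iota 1 h.+2 by rewrite mem_index_iota !ltnS (ltnW (ltn_ord i)).
exact: (geq_bigmin_seq id _ i_in ind).
Qed.

(** * The extremal graph, built from consecutive blocks *)

Section LayeredGraph.

(* [order] reads the vertices from the left or from the right, according to
   which of alpha^+ and alpha^- attains the minimum. *)
Variables (n : nat) (order : 'I_n -> 'I_n) (s l : nat).
Hypothesis order_inj : injective order.
Hypothesis s_gt0 : 0 < s.

Definition layer (v : 'I_n) : nat := order v %/ s.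

Lemma card_layer q : #|[set v | layer v == q]| <= s.
Proof.
apply: leq_trans (card_ord_divn n q s_gt0).
rewrite -[leqRHS](card_preimset _ order_inj); apply/subset_leq_card/subsetP => v.
by rewrite !inE.
Qed.

Lemma card_layers : l * s <= n -> #|[set v | layer v < l]| = l * s.
Proof.
move=> le_lsn; rewrite -[RHS](card_ord_ltn le_lsn) -[RHS](card_preimset _ order_inj).
by apply: eq_card => v; rewrite !inE ltn_divLR.
Qed.

Lemma layered_graph_no_perfect_tiling h (H : ordered_graph h) b :
  0 < n -> b * n < l * s * h -> l < interval_chromatic H ->
  (forall u v w : 'I_n, u <= v <= w -> layer u = layer w -> layer v = layer u) ->
  (forall phi, embedding H (class_graph layer l) phi ->
     #|[set i | layer (phi i) < l]| <= b) ->
  ~ exists T, perfect_tiling H (class_graph layer l) T.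
Proof.
move=> n_gt0 lt_b lt_l convex le_b [T perfT].
case: (leqP (l * s) n) => [le_lsn | lt_n].
  suff: l * s * h <= b * n by rewrite leqNgt lt_b.
  rewrite -(card_layers le_lsn); apply: perfect_tiling_card_leq perfT _ => phi.
  by move/le_b; congr (_ <= _); apply: eq_card => i; rewrite !inE.
(* Now the layers below [l] exhaust the vertices. As [n > 0], the tiling contains a copy, along
   which the layers pull back to a colouring of [H]. *)
have [phi /perfT.1.1 emb] : exists phi, phi \in T.
  have: Ordinal n_gt0 \in \bigcup_(phi in T) vertices phi by rewrite perfT.2 inE.
  by case/bigcupP=> phi Tphi _; exists phi.
have layer_lt v : layer v < l.
  by rewrite ltn_divLR //; apply: leq_trans (ltn_ord _) (ltnW lt_n).
suff: interval_chromatic H <= l by rewrite leqNgt lt_l.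
apply: (class_chromatic_leq (d := layer \o phi)) => //= [i j k /andP[ij jk]|i j].
  by apply: convex; rewrite !(embedding_homo_leq emb).
exact: (class_graph_embedding emb).
Qed.

End LayeredGraph.

(** * Arithmetic of the ratios, and the theorem *)

Lemma alpha_minus_leq h (H : ordered_graph h) l : alpha_minus H l <= h.+1.
Proof.
case: l => //= l; rewrite big_nat_cond.
elim/big_ind: _ => // [x y le_x _|k /andP[/andP[_ ]] //].
exact: leq_trans (geq_minl _ _) le_x.
Qed.

Local Open Scope ring_scope.

Lemma alpha_star_attained h (H : ordered_graph h) :
  (1 < interval_chromatic H)%N ->
  exists l, (0 < l < interval_chromatic H)%N /\ alpha_star H = alpha_ratio H l.
Proof.
move=> hH; rewrite /alpha_star big_nat.
elim/big_ind: _ => [|x y|l]; first by exists 1%N.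
  by rewrite minEle; case: ifP.
by exists l.
Qed.

Lemma alpha_ratio_cases h (H : ordered_graph h) l :
  alpha_ratio H l = (alpha_plus H l)%:R / (l * h)%:R \/
  alpha_ratio H l = (h.+1 - alpha_minus H l)%:R / (l * h)%:R.
Proof.
rewrite /alpha_ratio minEle natrB ?alpha_minus_leq // -[h.+1%:R]natr1 addrAC.
by case: ifP; [left | right].
Qed.

(** The floor is at most [n - a * n <= n - s]; the [- 1] absorbs the extra vertex in [s.+1]. *)
Lemma floor_degree_bound (F : archiRealFieldType) (a : F) n s d :
  s%:R <= a * n%:R -> (n - s.+1 <= d)%N ->
  Num.floor ((1 - a) * n%:R) - 1 <= d%:Z.
Proof.
move=> le_s le_d; rewrite lerBlDr -(ler_int F).
apply: le_trans (floor_le _) _; rewrite mulrBl mul1r lerBlDr.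
apply: le_trans (lerD (lexx _) le_s); rewrite intrD -!pmulrn -!natrD ler_nat.
by move: le_d; rewrite leq_subLR addSnnS addnC addn1.
Qed.

Theorem proposition1p5 (h : nat) (H : ordered_graph h)
    (hH : (1 < interval_chromatic H)%N)
    (n : nat) (hn : (0 < n)%N) (hdvd : (h %| n)%N) :
  exists G : ordered_graph n,
    Num.floor ((1 - alpha_star H) * n%:R) - 1 <= (min_degree G)%:Z /\
    ~ (exists T : {set {ffun 'I_h -> 'I_n}}, perfect_tiling H G T).
Proof.
have h_gt0 : (0 < h)%N by apply: dvdn_gt0 hdvd.
have [l [/andP[l_gt0 lt_l] ->]] := alpha_star_attained hH.
have lh_gt0 : (0 < l * h)%N by rewrite muln_gt0 l_gt0.
(* With [t b] the floor of [b * n / (l * h)], the size [s = (t b).+1] is the least one with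
   [b * n < l * s * h]. *)
pose t b := (b * n %/ (l * h))%N.
have degree_ok b (order : 'I_n -> 'I_n) : injective order ->
    Num.floor ((1 - b%:R / (l * h)%:R : rat) * n%:R) - 1
      <= (min_degree (class_graph (layer order (t b).+1) l))%:Z.
  move=> inj; apply: (@floor_degree_bound _ _ _ (t b)); last first.
    by apply: class_graph_min_degree => // q; apply: card_layer.
  by rewrite mulrAC ler_pdivlMr ?ltr0n // -!natrM ler_nat leq_divM.
have count_ok b : (b * n < l * (t b).+1 * h)%N.
  by rewrite mulnAC [ltnRHS]mulnC ltn_ceil.
have [-> | ->] := alpha_ratio_cases H l.
  set b := alpha_plus H l; pose order (v : 'I_n) := v.
  have inj : injective order by [].
  exists (class_graph (layer order (t b).+1) l); split; first exact: degree_ok.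
  have homo (u v : 'I_n) : (u <= v -> layer order (t b).+1 u <= layer order (t b).+1 v)%N.
    exact: leq_div2r.
  apply: (layered_graph_no_perfect_tiling inj) (count_ok b) lt_l _ _ => //.
    move=> u v w /andP[/homo uv /homo vw] eq_uw.
    by apply/eqP; rewrite eqn_leq uv eq_uw vw.
  move=> phi emb; apply: leq_card_ord_ltn => i; rewrite inE.
  apply: (alpha_plus_greedy (d := layer order (t b).+1 \o phi)) => [x y|x y] /=.
    by move=> /(embedding_homo_leq emb)/homo.
  exact: (class_graph_embedding emb).
set b := (h.+1 - alpha_minus H l)%N; pose order := @rev_ord n.
have inj : injective order by exact: rev_ord_inj.
exists (class_graph (layer order (t b).+1) l); split; first exact: degree_ok.
have homo (u v : 'I_n) :
    (u <= v -> layer order (t b).+1 v <= layer order (t b).+1 u)%N.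
  by move=> le_uv; apply: leq_div2r; apply: leq_sub2l.
apply: (layered_graph_no_perfect_tiling inj) (count_ok b) lt_l _ _ => //.
  move=> u v w /andP[/homo uv /homo vw] eq_uw.
  by apply/eqP; rewrite eqn_leq uv eq_uw vw.
(* Reversing [H] as well turns its final segment, from label [alpha_minus H l] on, into an initial
   one of length [b]. *)
move=> phi emb; rewrite -[leqLHS](card_preimset _ (@rev_ord_inj h)).
apply: leq_card_ord_ltn => i; rewrite !inE => lt_i.
suff: (alpha_minus H l <= (rev_ord i).+1)%N.
  by rewrite /= subnSK // leq_subRL ?(ltnW (ltn_ord i)) // ltn_subRL ltnS addnC.
apply: (alpha_minus_greedy (d := layer order (t b).+1 \o phi)) => [x y|x y|] //=.
  by move=> /(embedding_homo_leq emb)/homo.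
exact: (class_graph_embedding emb).
Qed.
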